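(* For every $K>0$ and every $C>0$, almost every biased process $\mathcal{G}_K$ on $n$ vertices satisfies $$|I(\mathcal{G}_K(t))-y(t)|=O(n^{-1/4})\quad\text{for every } 0\le t\le C,$$ where $y$ is the solution to the differential equation $$y'=\frac{(1-y)K}{y^2+(1-y^2)K}-1,\qquad y(0)=1.$$ In the special case $K=0$, almost every biased process $\mathcal{G}_0$ on $n$ vertices satisfies $$|I(\mathcal{G}_0(t))-y(t)|=O(n^{-1/4})\quad\text{for every } 0\le t\le 1,$$ where $y$ is the solution to the differential equation $y'=-1$, $y(0)=1$ (the case $K=0$ of the differential equation displayed in this statement), i.e. $y(t)=1-t$.
   Context: Biased graph process. For $K\in[0,\infty)$, the biased graph process on $n$ vertices, $\mathcal{G}_K=\mathcal{G}_K(n)$, is the random sequence of graphs $\mathcal{G}_K^0,\mathcal{G}_K^1,\dots$ on a fixed set of $n$ vertices, where $\mathcal{G}_K^0$ is the edgeless graph and $\mathcal{G}_K^m$ is obtained from $\mathcal{G}_K^{m-1}$ by adding one random missing edge, chosen with probability proportional to the following weights: a missing edge between two vertices that are both isolated in $\mathcal{G}_K^{m-1}$ has weight $1$, and every other missing edge has weight $K$. Once there are fewer than $2$ isolated vertices, the new edge is chosen uniformly among the missing edges. For $m>\binom n2$, $\mathcal{G}_K^m$ is the complete graph $K_n$. The time-scaled process is $\mathcal{G}_K(t)=\mathcal{G}_K^{\lfloor tn/2\rfloor}$ for real $t\ge 0$. For a graph $G$ on $n$ vertices, $I(G)$ is the fraction of isolated vertices, i.e. the number of isolated vertices of $G$ divided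 by $n$. ''Almost every process on $n$ vertices satisfies a property'' means that the corresponding event has probability tending to $1$ as $n\to\infty$ (with $K$ and $C$ fixed). The constant implied in $O(n^{-1/4})$ may depend on $K$ and $C$ but not on $n$ or $t$, and the event in question is that the bound holds simultaneously for all $t$ in the stated range. *)

(* Defs.v *)
From HB Require Import structures.
From mathcomp Require Import all_boot all_order all_algebra.
From mathcomp Require Import all_classical all_reals all_analysis.

Set Implicit Arguments.
Unset Strict Implicit.
Unset Printing Implicit Defensive.

Import Order.TTheory GRing.Theory Num.Theory.
Import numFieldNormedType.Exports.

Local Open Scope ring_scope.

Definition pairs (n : nat) : {set {set 'I_n}} := [set e : {set 'I_n} | #|e| == 2%N].

Record sgraph (n : nat) := SGraph {
  edges : {set {set 'I_n}};
  edges_pairs : edges \subset pairs n }.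

HB.instance Definition _ (n : nat) := [isSub for @edges n].
HB.instance Definition _ (n : nat) := [Finite of sgraph n by <:].

Definition edgeless (n : nat) : sgraph n := SGraph (finset.sub0set (pairs n)).

Definition missing (n : nat) (g : sgraph n) : {set {set 'I_n}} :=
  pairs n :\: edges g.

Definition isolated (n : nat) (g : sgraph n) : {set 'I_n} :=
  [set v : 'I_n | [forall e in edges g, v \notin e]].

Definition iso_frac (R : realType) (n : nat) (g : sgraph n) : R :=
  #|isolated g|%:R / n%:R.

Definition weight (R : realType) (K : R) (n : nat) (g : sgraph n)
    (e : {set 'I_n}) : R :=
  if (#|isolated g| < 2)%N then 1
  else if e \subset isolated g then 1 else K.

Definition step_prob (R : realType) (K : R) (n : nat) (g h : sgraph n) : R :=
  if missing g == finset.set0 then (h == g)%:R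
  else (\sum_(e in missing g | edges h == e |: edges g) weight K g e)
       / \sum_(e in missing g) weight K g e.

Local Open Scope classical_set_scope.

(* A random sequence of graphs on an arbitrary probability space whose
   finite-dimensional laws are those of the Markov chain started at the
   edgeless graph with transition probabilities [step_prob K]. *)
Definition biased_process (R : realType) (K : R) (n : nat)
    (d : measure_display) (T : measurableType d) (P : probability T R)
    (G : nat -> T -> sgraph n) : Prop :=
  [/\ forall (m : nat) (g : sgraph n), measurable [set w | G m w = g],
      P [set w | G 0%N w = edgeless n] = 1%E
    & forall (m : nat) (h : nat -> sgraph n),
        P [set w | forall i : nat, (i <= m.+1)%N -> G i w = h i] =
        (P [set w | forall i : nat, (i <= m)%N -> G i w = h i]
           * (step_prob K (h m) (h m.+1))%:E)%E].

(* [Num.truncn] is the integer part, as a natural number, for arguments >= 0. *)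
Definition at_time (R : realType) (n : nat) (T : Type)
    (G : nat -> T -> sgraph n) (t : R) : T -> sgraph n :=
  G (Num.truncn (t * n%:R / 2)).

Definition close_upto (R : realType) (n : nat) (T : Type)
    (G : nat -> T -> sgraph n) (y : R -> R) (C eps : R) : set T :=
  [set w | forall t : R, 0 <= t <= C ->
     `|iso_frac R (at_time G t w) - y t| <= eps].

Definition ode_rhs (R : realType) (K y : R) : R :=
  (1 - y) * K / (y ^+ 2 + (1 - y ^+ 2) * K) - 1.

(* [y] solves y' = f(y), y(0) = y0 on [0, C]; by continuity of [y] on the closed
   interval, the equation also holds for the one-sided derivatives at the
   endpoints whenever [f] is continuous there. *)
Definition solves_ivp (R : realType) (f : R -> R) (y0 C : R) (y : R -> R)
    : Prop :=
  [/\ y 0 = y0,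
      {within `[0, C], continuous y}
    & forall t : R, 0 < t < C -> is_derive t 1 y (f (y t))].

(* Main.v *)
Require Import Defs.
From HB Require Import structures.
From mathcomp Require Import all_boot all_order all_algebra.
From mathcomp Require Import all_classical all_reals all_analysis.
From mathcomp Require Import ring lra zify.

Import Order.TTheory GRing.Theory Num.Theory.
Import numFieldNormedType.Exports.

(** Let I be the number of isolated vertices after m steps. A step destroys 0, 1 or
    2 of them, and a count of pairs shows that the mean loss is, up to O(1/n),
    - 2 f(I/n), where f is the right-hand side of the equation: a graph with O(n)
    edges has so few of them that its other details do not matter
    ([mean_loss_drift]). The solution moves by (2/n) f(y) + O(1/n^2) in the same
    amount of time ([solution_euler]). As f is Lipschitz on [0, 1], where both I/n
    and y stay, the deviation u = I - n y(2m/n) changes in one step by a mean amount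
    of at most O((1 + |u|)/n), and by a bounded amount in any case. So its second
    moment is multiplied by at most 1 + O(1/n) and increased by at most O(1) in one
    step ([second_moment_recursion]), and is O(n) during the O(n) steps
    considered ([second_moment_bound]).

    By Chebyshev's inequality, |u| exceeds n^(3/4) at a given time with
    probability O(n^(-1/2)). It suffices to control O(n^(1/4)) times at distance
    about n^(3/4) from each other, because in between neither I nor n y can change by
    more than O(n^(3/4)) ([close_of_grid]). The union bound over these times then
    gives a failure probability O(n^(-1/4)) ([prob_close]). This replaces a
    maximal inequality for martingales, so that only finite sums against the
    one-time laws of the process occur ([expectation_succ]).

    The solution stays in [0, 1] because f is positive just below 0 and negative
    just above 1 ([solution_barrier]).

    If K = 0, every step joins two isolated vertices as long as there are two, so
    that I = n - 2m outside a null set ([path_isolated0]). *)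

Set Implicit Arguments.
Unset Strict Implicit.
Unset Printing Implicit Defensive.

Local Open Scope classical_set_scope.
Local Open Scope ring_scope.

Local Notation isolated := Defs.isolated.

(** * Finite-state processes *)

Section FiniteState.
Context (R : realType) (d : measure_display) (T : measurableType d).
Variable (P : probability T R).
Implicit Types (S : finType) (A : set T).

Lemma measurable_fin_preimage S (Y : T -> S) (Q : set S) :
  (forall s, measurable [set w | Y w = s]) -> measurable [set w | Q (Y w)].
Proof.
move=> mY.
rewrite (_ : [set w | _] = \bigcup_(s in Q) [set w | Y w = s]); last first.
  by apply/seteqP; split=> [w Qw|w [s Qs /= ->//]]; exists (Y w).
by apply: fin_bigcup_measurable => //; exact: finite_finset.
Qed.

Lemma prob_split S (Y : T -> S) A :
  (forall s, measurable [set w | Y w = s]) -> measurable A ->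
  P A = (\sum_s P (A `&` [set w | Y w = s]))%E.
Proof.
move=> mY mA.
rewrite {1}(_ : A = \bigcup_(s in [set: S]) (A `&` [set w | Y w = s])); last first.
  by apply/seteqP; split=> [w Aw|w [s _ []//]]; exists (Y w).
rewrite measure_fin_bigcup //; last first.
- by move=> s _; apply: measurableI.
- by apply/trivIsetP => s s' _ _ ss'; apply/seteqP; split=> // w /= [[_ ->] [_ /eqP]];
     rewrite (negbTE ss').
- exact: finite_finset.
rewrite (_ : [set: S] = [set` index_enum S]) -?fsbig_seq ?index_enum_uniq//.
by apply/seteqP; split=> // s _ /=; exact: mem_index_enum.
Qed.

End FiniteState.

Section ChainLaw.
Context (R : realType) (K : R) (n : nat) (d : measure_display).
Context (T : measurableType d) (P : probability T R) (G : nat -> T -> sgraph n).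
Hypothesis GK : biased_process K P G.

Definition law (m : nat) (g : sgraph n) : R := fine (P [set w | G m w = g]).

Let mG m g : measurable [set w | G m w = g].
Proof. by case: GK. Qed.

Lemma lawE m g : P [set w | G m w = g] = (law m g)%:E.
Proof. by rewrite fineK ?fin_num_measure. Qed.

Lemma law_ge0 m g : 0 <= law m g.
Proof. exact: fine_ge0. Qed.

Lemma prob_predE m (Q : pred (sgraph n)) :
  P [set w | Q (G m w)] = (\sum_(g | Q g) law m g)%:E.
Proof.
rewrite (prob_split P (mG m)); last exact: (measurable_fin_preimage Q).
rewrite -sumEFin [RHS]big_mkcond/=; apply: eq_bigr => g _; case: ifPn => Qg.
  rewrite -lawE; congr (P _); apply/seteqP; split=> [w []//|w /= Gw].
  by rewrite Gw.
rewrite (_ : _ `&` _ = set0) ?measure0//.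
by apply/seteqP; split=> // w /= [+ Gw]; rewrite Gw (negbTE Qg).
Qed.

Lemma prob_chebyshev m (D : sgraph n -> R) (l A : R) :
  0 < l -> \sum_g law m g * D g ^+ 2 <= A ->
  (P [set w | (l <= `|D (G m w)|)%R] <= (A / l ^+ 2)%:E)%E.
Proof.
move=> l0 DA; rewrite (prob_predE m (fun g => l <= `|D g|)) lee_fin.
rewrite ler_pdivlMr ?exprn_gt0// mulr_suml; apply: le_trans DA.
rewrite [leLHS]big_mkcond; apply: ler_sum => g _; case: ifP => [lD|_]; last first.
  by rewrite mulr_ge0 ?sqr_ge0// law_ge0.
rewrite ler_wpM2l ?law_ge0// -(real_normK (num_real (D g))).
by rewrite ler_pXn2r// ?nnegrE// ltW.
Qed.

Lemma law_sum1 m : \sum_g law m g = 1.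
Proof.
apply: EFin_inj; rewrite -(prob_predE m predT) -(probability_setT P).
by congr (P _); apply/seteqP.
Qed.

(** The finite-dimensional laws prescribe whole histories; summing them over all
    the histories that end in a given graph leaves the transition law. *)
Lemma prob_transition m g h :
  P ([set w | G m w = g] `&` [set w | G m.+1 w = h]) =
  (law m g * step_prob K g h)%:E.
Proof.
pose Y w : {ffun 'I_m.+1 -> sgraph n} := [ffun i => G (i : 'I__) w].
have mY f : measurable [set w | Y w = f].
  rewrite (_ : [set w | _] =
     \bigcap_(i in [set: 'I_m.+1]) [set w | G i w = f i]); last first.
    apply/seteqP; split=> [w <- i _ /=|w fw /=]; first by rewrite ffunE.
    by apply/ffunP => i; rewrite ffunE fw.
  apply: fin_bigcap_measurable => //; exact: finite_finset.
have hY f w : Y w = f <->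
    forall i : nat, (i <= m)%N -> G i w = f (inord i).
  split=> [<- i im|fw]; first by rewrite ffunE inordK.
  by apply/ffunP => i; rewrite ffunE fw ?inord_val// -ltnS.
rewrite (prob_split P mY); last exact: measurableI.
rewrite EFinM -lawE (prob_split P mY)// ge0_sume_distrl; last by [].
apply: eq_bigr => f _.
case: GK => _ _ /(_ m (fun i => if (i <= m)%N then f (inord i) else h)) /=.
rewrite leqnn ltnn => GKm.
have [fm|fm] := eqVneq (f ord_max) g; last first.
  have em A : [set w | G m w = g] `&` A `&` [set w | Y w = f] = set0.
    apply/seteqP; split=> // w /= [[gw _] fw]; case/eqP: fm.
    by rewrite -fw ffunE.
  by rewrite em -(setIT [set w | G m w = g]) em measure0 mul0e.
rewrite (_ : inord m = ord_max) in GKm; last by apply/val_inj; rewrite /= inordK.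
rewrite fm in GKm.
transitivity (P [set w | forall i, (i <= m.+1)%N ->
    G i w = (if (i <= m)%N then f (inord i) else h)]).
  congr (P _); apply/seteqP; split=> [w /= [[gw hw] fw] i im|w /= fw].
    case: leqP => im'; first by move/hY: fw => ->.
    by rewrite (_ : i = m.+1)//; apply/eqP; rewrite eqn_leq im.
  have fw' : Y w = f by apply/hY => i im; rewrite fw ?im// (leq_trans im).
  split=> //; split; last by rewrite fw// ltnn.
  by rewrite -fm -fw' ffunE.
rewrite GKm; congr (P _ * _)%E; apply/seteqP; split=> [w /= fw|w /= [_ /hY fw] i im].
  have fw' : Y w = f by apply/hY => i im; rewrite fw ?im.
  by split=> //; rewrite -fm -fw' ffunE.
by rewrite fw// im.
Qed.

Lemma law_succ m h : law m.+1 h = \sum_g law m g * step_prob K g h.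
Proof.
apply: EFin_inj; rewrite -lawE (prob_split P (mG m))// -sumEFin.
by apply: eq_bigr => g _; rewrite -prob_transition setIC.
Qed.

Lemma expectation_succ m (F : sgraph n -> R) :
  \sum_h law m.+1 h * F h = \sum_g law m g * \sum_h step_prob K g h * F h.
Proof.
under eq_bigr do rewrite law_succ mulr_suml.
rewrite exchange_big /=; apply: eq_bigr => g _; rewrite mulr_sumr.
by apply: eq_bigr => h _; rewrite mulrA.
Qed.

Lemma law0 g : law 0 g = (g == edgeless n)%:R.
Proof.
have l1 : law 0 (edgeless n) = 1.
  by apply: EFin_inj; rewrite -lawE; case: GK.
case: eqVneq => [->//|ng]; have := law_sum1 0.
rewrite (bigD1 (edgeless n))//= l1 (bigD1 g)//=.
have : 0 <= \sum_(i | (i != edgeless n) && (i != g)) law 0 i.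
  by apply: sumr_ge0 => i _; exact: law_ge0.
by have := law_ge0 0 g; lra.
Qed.

(** Outside this set the trajectory obeys the rules of the process literally. *)
Definition illegal : set T :=
  [set w | G 0 w <> edgeless n] `|`
  \bigcup_m [set w | step_prob K (G m w) (G m.+1 w) = 0].

Let illegalm m :
  measurable [set w | step_prob K (G m w) (G m.+1 w) = 0] /\
  P [set w | step_prob K (G m w) (G m.+1 w) = 0] = 0%E.
Proof.
have mY (p : sgraph n * sgraph n) : measurable [set w | (G m w, G m.+1 w) = p].
  rewrite (_ : [set w | _] =
    [set w | G m w = p.1] `&` [set w | G m.+1 w = p.2]); first exact: measurableI.
  case: p => g h; apply/seteqP; split=> w /=; first by case=> -> ->.
  by case=> -> ->.
have mB := measurable_fin_preimage (fun p => step_prob K p.1 p.2 = 0) mY.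
split=> //; rewrite (prob_split P mY)// big1// => -[g h] _ /=.
have [s0|s0] := eqVneq (step_prob K g h) 0; last first.
  rewrite (_ : _ `&` _ = set0) ?measure0//.
  by apply/seteqP; split=> // w /= [+ [Gg Gh]]; rewrite Gg Gh; exact/eqP.
rewrite (_ : _ `&` _ = [set w | G m w = g] `&` [set w | G m.+1 w = h]).
  by rewrite prob_transition s0 mulr0.
apply/seteqP; split=> w /=; first by case=> _ [-> ->].
by case=> -> ->.
Qed.

Lemma measurable_illegal : measurable illegal.
Proof.
apply: measurableU.
  exact: (measurable_fin_preimage (fun g => g <> edgeless n)).
by apply: bigcupT_measurable => m; have [] := illegalm m.
Qed.

Lemma prob_illegal : P illegal = 0%E.
Proof.
apply: measure_negligible; first exact: measurable_illegal.
apply: negligibleU; last first.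
  by apply: negligible_bigcup => m; apply/negligibleP; have [] := illegalm m.
have m0 := measurable_fin_preimage (fun g => g <> edgeless n) (mG 0).
apply/negligibleP => //.
rewrite (_ : [set w | _] = [set w | G 0 w != edgeless n]).
  have /= -> := prob_predE 0 (fun g => g != edgeless n).
  rewrite big1// => g /negbTE ng.
  by rewrite law0 ng.
by apply/seteqP; split=> w /= /eqP.
Qed.

End ChainLaw.

(** * One step of the biased graph process *)

Section OneStep.
Context (R : realType) (K : R) (n : nat).
Implicit Types (g h : sgraph n) (e : {set 'I_n}).

Definition loss g e : nat := #|isolated g :&: e|.

Definition total_weight g : R := \sum_(e in missing g) weight K g e.

Definition mean_loss g : R :=
  (\sum_(e in missing g) weight K g e * (loss g e)%:R) / total_weight g.

Lemma card_missing_edge g e : e \in missing g -> #|e| = 2%N.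
Proof. by rewrite !inE => /andP[_ /eqP]. Qed.

Lemma isolated_edge g e : e \in edges g -> isolated g :&: e = finset.set0.
Proof.
move=> eg; apply/finset.setP => v; rewrite !inE.
by apply/andP => -[/forall_inP /(_ e eg) /negP].
Qed.

Lemma isolated_add g h e :
  edges h = e |: edges g -> isolated h = isolated g :\: e.
Proof.
move=> hE; apply/finset.setP => v; rewrite !inE hE.
apply/forall_inP/andP => [vh|[ve /forall_inP vg] f].
  split; first by apply: vh; rewrite !inE eqxx.
  by apply/forall_inP => f fg; apply: vh; rewrite !inE fg orbT.
by rewrite !inE => /orP[/eqP->//|/vg].
Qed.

Lemma card_isolated_add g h e : edges h = e |: edges g ->
  #|isolated h|%:R = #|isolated g|%:R - (loss g e)%:R :> R.
Proof. by move=> /isolated_add ->; rewrite cardsD natrB// subset_leq_card ?finset.subsetIl. Qed.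

Lemma loss_le2 g e : e \in missing g -> (loss g e <= 2)%N.
Proof. by move=> /card_missing_edge <-; rewrite subset_leq_card ?finset.subsetIr. Qed.

Lemma add_edge g e : e \in missing g -> exists h, edges h = e |: edges g.
Proof.
rewrite inE => /andP[_ ep].
have s : e |: edges g \subset pairs n by rewrite finset.subUset finset.sub1set ep edges_pairs.
by exists (SGraph s).
Qed.

(** The value of the observable depends on the successor graph only, so that
    grouping the missing edges by successor turns into a sum over the edges. *)
Lemma step_expectation g (F : sgraph n -> R) (f : {set 'I_n} -> R) :
  missing g != finset.set0 ->
  (forall e h, e \in missing g -> edges h = e |: edges g -> F h = f e) ->
  \sum_h step_prob K g h * F h =
  (\sum_(e in missing g) weight K g e * f e) / total_weight g.
Proof.
move=> mg Ff; rewrite /step_prob (negbTE mg).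
under eq_bigr => h _ do rewrite mulrAC.
rewrite -mulr_suml; congr (_ / _).
under eq_bigr => h _ do rewrite mulr_suml.
rewrite (exchange_big_dep (fun e => e \in missing g))/=; last by move=> h e _ /andP[].
apply: eq_bigr => e eg; have [h0 h0E] := add_edge eg.
rewrite (big_pred1 h0) ?(Ff e)// => h /=.
by rewrite eg -h0E; apply/eqP/eqP => [/val_inj|->].
Qed.

Lemma step_possible g h : step_prob K g h != 0 ->
  (missing g = finset.set0 /\ h = g) \/
  exists e, [/\ e \in missing g, edges h = e |: edges g & weight K g e != 0].
Proof.
rewrite /step_prob; case: (eqVneq (missing g)) => [m0|_].
  by rewrite pnatr_eq0 eqb0 negbK => /eqP ->; left.
rewrite mulf_eq0 negb_or => /andP[+ _] => s0; right; apply: contrapT => ne.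
move/eqP: s0; apply; apply: big1 => e /andP[eg /eqP he].
by apply: contrapT => /eqP w0; apply: ne; exists e.
Qed.

Lemma step_isolated g h : step_prob K g h != 0 ->
  (#|isolated h| <= #|isolated g| <= #|isolated h| + 2)%N.
Proof.
case/step_possible => [[_ ->]|[e [eg he _]]]; first by rewrite leqnn leq_addr.
rewrite (isolated_add he) subset_leq_card ?finset.subsetDl//= cardsD -leq_subLR.
by rewrite subKn ?subset_leq_card ?finset.subsetIl//; exact: (loss_le2 eg).
Qed.

Lemma step_edges g h : step_prob K g h != 0 -> (#|edges h| <= #|edges g|.+1)%N.
Proof.
by case/step_possible => [[_ ->]//|[e [_ -> _]]]; rewrite cardsU1; case: (_ \notin _).
Qed.

Lemma total_weight_missing g : total_weight g != 0 -> missing g != finset.set0.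
Proof. by apply: contra => /eqP m0; rewrite /total_weight m0 finset.big_set0. Qed.

(** Expand the square: a step lowers the number of isolated vertices by at most
    two, so the last term of the expansion is at most 4, and the middle one only
    involves the mean loss. *)
Lemma second_moment_step g (a delta : R) :
  0 <= K -> total_weight g != 0 -> -2 <= delta <= 0 ->
  \sum_h step_prob K g h * (#|isolated h|%:R - (a + delta)) ^+ 2 <=
  (#|isolated g|%:R - a) ^+ 2
  - 2 * (#|isolated g|%:R - a) * (mean_loss g + delta) + 4.
Proof.
move=> K0 W0 dl; set u := #|isolated g|%:R - a.
have w0 e : 0 <= weight K g e by rewrite /weight; do 2?case: ifP => // _.
have Wp : 0 < total_weight g by rewrite lt0r W0 sumr_ge0.
rewrite (@step_expectation g _ (fun e => (u - ((loss g e)%:R + delta)) ^+ 2)); first last.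
- by move=> e h eg he; rewrite (card_isolated_add he) /u; congr (_ ^+ 2); ring.
- exact: total_weight_missing.
rewrite ler_pdivrMr//.
rewrite (_ : _ * total_weight g = (u ^+ 2 - 2 * u * delta + 4) * total_weight g
  - 2 * u * \sum_(e in missing g) weight K g e * (loss g e)%:R); last first.
  by rewrite /mean_loss; field.
rewrite /total_weight !mulr_sumr -sumrB; apply: ler_sum => e eg.
have l2 : (loss g e)%:R <= 2 :> R by rewrite ler_nat loss_le2.
have l0 : 0 <= (loss g e)%:R :> R by [].
have := w0 e; move: (weight K g e) (loss g e)%:R l0 l2 => w l l0 l2 wp.
rewrite -subr_ge0 (_ : _ - _ = w * ((2 - (l + delta)) * (2 + (l + delta)))); last by ring.
by apply: mulr_ge0 => //; apply: mulr_ge0; lra.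
Qed.

End OneStep.

Section Counts.
Context (R : realType) (n : nat).
Implicit Types (g : sgraph n) (A : {set 'I_n}).

Lemma sum_pairs_in A :
  \sum_(e in pairs n) (e \subset A)%:R = ('C(#|A|, 2))%:R :> R.
Proof.
rewrite -cards_draws -sum1_card natr_sum big_mkcond [RHS]big_mkcond/=.
by apply: eq_bigr => e _; rewrite !inE andbC; case: (#|e| == 2%N); case: (e \subset A).
Qed.

Lemma card_pairs : #|pairs n| = 'C(n, 2).
Proof.
rewrite -[n in RHS]card_ord -cardsT -cards_draws; apply: eq_card => e.
by rewrite !inE finset.subsetT.
Qed.

Lemma bin2R (m : nat) : ('C(m, 2))%:R = m%:R * (m%:R - 1) / 2 :> R.
Proof.
have := congr1 (fun k : nat => k%:R : R) (mul_bin_diag m 1).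
rewrite bin1 natrM [in RHS]natrM.
case: m => [|m]; first by rewrite bin0n; lra.
by rewrite succnK -natr1; lra.
Qed.

Lemma sum_missing g (F : {set 'I_n} -> R) :
  \sum_(e in missing g) F e = \sum_(e in pairs n) F e - \sum_(e in edges g) F e.
Proof.
rewrite [in X in X - _](big_setID (edges g)) (finset.setIidPr (edges_pairs g)).
by rewrite /missing addrAC subrr add0r.
Qed.

(** Both sides only depend on whether the pair meets [A] in 0, 1 or 2 points.
    The right-hand side reduces the weighted sums over edges to numbers of pairs
    inside a set. *)
Lemma card_pairI A (e : {set 'I_n}) : #|e| = 2%N ->
  #|A :&: e|%:R = 1 + (e \subset A)%:R - (e \subset ~: A)%:R :> R.
Proof.
move=> e2.
have -> : (e \subset A) = (#|A :&: e| == 2)%N.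
  by rewrite -e2 finset.setIC; apply/finset.setIidPl/eqP => [->//|c];
     apply/eqP; rewrite eqEcard finset.subsetIl c leqnn.
have -> : (e \subset ~: A) = (#|A :&: e| == 0)%N.
  by rewrite cards_eq0 finset.setI_eq0 disjoint_sym finset.disjoints_subset.
have : (#|A :&: e| <= 2)%N by rewrite -e2 subset_leq_card ?finset.subsetIr.
by case: #|_| => [|[|[|]]]//= _; lra.
Qed.

Lemma edge_not_isolated g e : e \in edges g -> e \subset isolated g = false.
Proof.
move=> eg; apply/negP => /finset.setIidPr; rewrite isolated_edge// => e0.
have := fintype.subsetP (edges_pairs g) e eg.
by rewrite inE -e0 cards0.
Qed.

End Counts.

(** * The mean loss of isolated vertices in one step *)

Section Drift.
Context (R : realType) (K : R) (n : nat).
Implicit Types (g : sgraph n).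

Lemma card_isolatedC g : #|~: isolated g|%:R = n%:R - #|isolated g|%:R :> R.
Proof. by rewrite cardsCs finset.setCK card_ord natrB// -[n in (_ <= n)%N]card_ord max_card. Qed.

(** All edges have an endpoint that is not isolated, hence would have weight [K]
    if they were missing: the total weight is that of all pairs minus [K] times
    the number of edges. *)
Lemma total_weight_ge2 g : (2 <= #|isolated g|)%N ->
  total_weight K g = 'C(#|isolated g|, 2)%:R
    + K * ('C(n, 2)%:R - 'C(#|isolated g|, 2)%:R) - K * #|edges g|%:R.
Proof.
move=> i2; rewrite /total_weight sum_missing.
rewrite (eq_bigr (fun e : {set 'I_n} => K + (1 - K) * (e \subset isolated g)%:R)); last first.
  by move=> e _; rewrite /weight ltnNge i2/=; case: ifP => _; rewrite ?mulr1 ?mulr0; ring.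
rewrite [X in _ - X](eq_bigr (fun=> K)); last first.
  by move=> e eg; rewrite /weight ltnNge i2 edge_not_isolated.
by rewrite big_split/= -mulr_sumr sum_pairs_in !sumr_const card_pairs -![K *+ _]mulr_natr; ring.
Qed.

Lemma loss_edge g e : e \in edges g -> loss g e = 0%N.
Proof. by move=> /isolated_edge; rewrite /loss => ->; rewrite cards0. Qed.

(** An edge of the graph would destroy no isolated vertex, so the sum may be
    taken over all pairs. *)
Lemma weighted_loss_ge2 g : (2 <= #|isolated g|)%N ->
  \sum_(e in missing g) weight K g e * (loss g e)%:R =
  2 * 'C(#|isolated g|, 2)%:R
  + K * ('C(n, 2)%:R - 'C(#|isolated g|, 2)%:R - 'C(#|~: isolated g|, 2)%:R).
Proof.
move=> i2; rewrite sum_missing.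
rewrite [X in _ - X]big1 ?subr0; last by move=> e eg; rewrite loss_edge// mulr0.
rewrite (eq_bigr (fun e : {set 'I_n} => K + (2 - K) * (e \subset isolated g)%:R
    - K * (e \subset ~: isolated g)%:R)); last first.
  move=> e; rewrite inE => /eqP e2; rewrite /weight ltnNge i2/= /loss card_pairI//.
  have [eI|eI] := boolP (e \subset _); last by case: (e \subset _) => /=; ring.
  suff -> : (e \subset ~: isolated g) = false by rewrite /=; ring.
  apply/negP => eC; suff : e \subset finset.set0 by rewrite finset.subset0 -cards_eq0 e2.
  by rewrite -(finset.setICr (isolated g)) finset.subsetI eI.
rewrite big_split/= sumrN big_split/= -!mulr_sumr !sum_pairs_in !sumr_const card_pairs.
by rewrite -![K *+ _]mulr_natr; ring.
Qed.

Lemma total_weight_lt2 g : (#|isolated g| < 2)%N ->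
  total_weight K g = 'C(n, 2)%:R - #|edges g|%:R.
Proof.
move=> i2; rewrite /total_weight /weight i2 sumr_const /missing cardsD.
rewrite (finset.setIidPr (edges_pairs g)) natrB ?subset_leq_card ?edges_pairs//.
by rewrite card_pairs.
Qed.

Lemma weighted_loss_lt2 g : (#|isolated g| < 2)%N ->
  \sum_(e in missing g) weight K g e * (loss g e)%:R =
  'C(n, 2)%:R + 'C(#|isolated g|, 2)%:R - 'C(#|~: isolated g|, 2)%:R.
Proof.
move=> i2; rewrite sum_missing.
rewrite [X in _ - X]big1 ?subr0; last by move=> e eg; rewrite loss_edge// mulr0.
rewrite (eq_bigr (fun e : {set 'I_n} => 1 + (e \subset isolated g)%:R
    - (e \subset ~: isolated g)%:R)); last first.
  by move=> e; rewrite inE => /eqP e2; rewrite /weight i2 /loss card_pairI// mul1r.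
by rewrite big_split/= sumrN big_split/= !sum_pairs_in sumr_const card_pairs.
Qed.

Lemma ode_rhsE (x N : R) : 0 < K -> 0 < N -> 0 <= x <= N ->
  ode_rhs K (x / N) =
  - ((x ^+ 2 + K * (x * (N - x))) / (x ^+ 2 + K * (N ^+ 2 - x ^+ 2))).
Proof.
move=> K0 N0 xN; have N0' : N != 0 by rewrite gt_eqF.
have b0 : 0 < x ^+ 2 + K * (N ^+ 2 - x ^+ 2).
  have [xN'|xN'] := ltP x N; last first.
    by rewrite (_ : x = N) ?subrr ?mulr0 ?addr0 ?exprn_gt0//; lra.
  have : 0 < K * ((N - x) * (N + x)) by rewrite !mulr_gt0//; lra.
  by nra.
rewrite /ode_rhs; field.
rewrite N0' gt_eqF// mulrC (mulrC (_ - _) K); nra.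
Qed.

End Drift.

(** With [x] isolated vertices among [N], put [a] and [b] for [N ^+ 2] times the
    numerator and the denominator of the right-hand side of the equation. Then the
    weighted loss is [a - x] and twice the total weight is [b - r], where the
    remainder [r], which accounts for the edges already present, is of order [N]
    as long as there are at most [C * N / 2] of them. As [b] is of order [N ^+ 2],
    both corrections change the quotient by [O(1/N)]. *)
Lemma mean_loss_drift (R : realType) (K C : R) : 0 < K -> 0 < C ->
  exists c N0 : R, 0 <= c /\ forall (n : nat) (g : sgraph n), N0 <= n%:R ->
    #|edges g|%:R <= C * n%:R / 2 ->
    total_weight K g != 0 /\
    `|mean_loss K g + 2 * ode_rhs K (#|isolated g|%:R / n%:R)| <= c / n%:R.
Proof.
move=> K0 C0; pose b0 := Num.min 1 K; pose c0 := 1 + K + K * C.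
have b0_gt0 : 0 < b0 by rewrite lt_min ltr01.
have b01 : b0 <= 1 by rewrite ge_min lexx.
have b0K : b0 <= K by rewrite ge_min lexx orbT.
have c01 : 1 <= c0 by rewrite /c0; nra.
exists (4 + 6 * c0 / b0), (1 + 2 * (1 + C) + 2 * c0 / b0).
have bc : 0 < c0 / b0 by rewrite divr_gt0//; lra.
split; first by rewrite -mulrA; lra.
move=> n g; rewrite -!mulrA => nN; set m := #|edges g|%:R => mC.
have : 0 <= m by [].
have := total_weight_ge2 K (g := g); have := weighted_loss_ge2 K (g := g).
have := total_weight_lt2 K (g := g); have := weighted_loss_lt2 K (g := g).
rewrite /mean_loss; move: (total_weight _ _) (\sum_(_ in _) _) => W S.
rewrite !bin2R card_isolatedC -/m; move: m mC => m mC Sl Wl Sg Wg m0.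
set x := #|isolated g|%:R; set N := n%:R in nN mC *.
have x0 : 0 <= x by [].
have xN : x <= N by rewrite ler_nat -[n in (_ <= n)%N]card_ord max_card.
have N0 : 0 < N by nra.
rewrite -/x -/N in Sl Wl Sg Wg.
rewrite ode_rhsE ?x0//.
set a := x ^+ 2 + K * (x * (N - x)); set b := x ^+ 2 + K * (N ^+ 2 - x ^+ 2).
have bN : b0 * N ^+ 2 <= b.
  rewrite /b (_ : _ + _ = x * x * (1 - b0) + (K - b0) * ((N - x) * (N + x))
    + b0 * N ^+ 2); last by ring.
  rewrite lerDr addr_ge0 ?mulr_ge0//; lra.
have b_gt0 : 0 < b by apply: lt_le_trans bN; rewrite mulr_gt0// exprn_gt0.
have a0 : 0 <= a by rewrite addr_ge0 ?sqr_ge0// !mulr_ge0//; lra.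
have ab : a <= b.
  rewrite -subr_ge0 /a /b (_ : _ - _ = K * ((N - x) * N)); last by ring.
  rewrite !mulr_ge0//; lra.
have cN : 2 * c0 <= b0 * N.
  have : 2 * (c0 / b0) * b0 <= N * b0 by rewrite ler_pM2r//; nra.
  by rewrite -mulrA divfK ?gt_eqF//; lra.
have [i2|i2] := ltnP #|isolated g| 2.
  (* The weights are uniform here, and with at most one isolated vertex the mean
     loss and the right-hand side are both O(1/N). *)
  rewrite Wl// Sl//.
  have xx : x ^+ 2 = x by rewrite /x -natrX; case: #|_| i2 => [|[|]].
  have N2 : 0 < N ^+ 2 by rewrite exprn_gt0.
  have W0 : N ^+ 2 / 4 <= N * (N - 1) / 2 - m by nra.
  have Wp : 0 < N * (N - 1) / 2 - m by apply: lt_le_trans W0; rewrite divr_gt0.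
  split; first by rewrite gt_eqF.
  rewrite (_ : _ - _ * _ / 2 = x * (N - 1)); last by field: xx.
  have x1 : x <= 1 by rewrite lern1 -ltnS.
  have s0 : 0 <= x * (N - 1) / (N * (N - 1) / 2 - m).
    by rewrite divr_ge0 ?mulr_ge0//; lra.
  have s1 : x * (N - 1) / (N * (N - 1) / 2 - m) <= 4 / N.
    rewrite ler_pdivrMr//; apply: (@le_trans _ _ (4 / N * (N ^+ 2 / 4))).
      by rewrite (_ : _ * (_ / _) = N); [nra|field; rewrite gt_eqF].
    by rewrite ler_wpM2l// divr_ge0// ltW.
  have f0 : 0 <= a / b by rewrite divr_ge0// ltW.
  have f1 : a / b <= c0 / b0 / N.
    rewrite ler_pdivrMr//; apply: (@le_trans _ _ (c0 / b0 / N * (b0 * N ^+ 2))).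
      rewrite (_ : _ * (_ * _) = c0 * N); last by field; rewrite !gt_eqF.
      have : K * (x * (N - x)) <= K * N by rewrite ler_pM2l//; nra.
      have : 0 <= K * C * N by rewrite !mulr_ge0// ltW.
      by rewrite /a /c0 xx; lra.
    by rewrite ler_wpM2l// divr_ge0// ltW.
  rewrite ler_norml mulrDl; have : 0 <= c0 / b0 / N by rewrite divr_ge0// ltW.
  rewrite -mulrA; lra.
rewrite Wg// Sg//.
have Nx : 0 <= N - x by lra.
pose r := x + K * (N - x) + 2 * K * m.
have rc : r <= c0 * N.
  rewrite /r /c0; have := ler_wpM2l (ltW K0) mC.
  have : 0 <= K * x by rewrite mulr_ge0// ltW.
  lra.
have r0 : 0 <= r by rewrite /r !addr_ge0 ?mulr_ge0//; lra.
have br : b0 * N ^+ 2 / 2 <= b - r by nra.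
have br0 : 0 < b - r by apply: lt_le_trans br; rewrite divr_gt0// mulr_gt0// exprn_gt0.
rewrite (_ : _ - K * m = (b - r) / 2); last by rewrite /b /r; field.
split; first by rewrite mulf_neq0 ?gt_eqF//; lra.
rewrite (_ : 2 * _ + K * _ = a - x); last by rewrite /a; field.
rewrite (_ : _ / _ + _ = 2 * (a * r - x * b) / ((b - r) * b)); last first.
  by field; rewrite !gt_eqF.
rewrite normrM [X in _ * X]ger0_norm; last by rewrite invr_ge0 mulr_ge0// ltW.
rewrite ler_pdivrMr ?mulr_gt0//.
apply: (@le_trans _ _ (2 * (c0 * N * b))).
  rewrite normrM ger0_norm// ler_pM2l// ler_norml.
  have : a * r <= b * (c0 * N) by rewrite ler_pM.
  have : x * b <= c0 * N * b by rewrite ler_pM2r//; nra.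
  have : 0 <= a * r by rewrite mulr_ge0.
  have : 0 <= x * b by rewrite mulr_ge0// ltW.
  lra.
apply: (@le_trans _ _ (4 * (c0 / b0) / N * (b0 * N ^+ 2 / 2 * b))).
  rewrite le_eqVlt; apply/orP; left; apply/eqP; field; rewrite !gt_eqF//.
have p1 : 0 <= 4 * (c0 / b0) / N.
  by apply: divr_ge0; [apply: mulr_ge0 => //|]; exact: ltW.
have p2 : 0 <= b0 * N ^+ 2 / 2 * b.
  apply: mulr_ge0; last exact: ltW.
  by apply: divr_ge0 => //; apply: mulr_ge0; rewrite ?sqr_ge0// ltW.
apply: (ler_pM p1 p2); last by rewrite ler_pM2r.
rewrite ler_pM2r ?invr_gt0//; lra.
Qed.

(** * The differential equation *)

Lemma solution_mvt (R : realType) (f : R -> R) (y0 C : R) (y : R -> R) (s t : R) :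
  solves_ivp f y0 C y -> 0 <= s -> s < t -> t <= C ->
  exists2 u, s < u < t & y t - y s = f (y u) * (t - s).
Proof.
case=> _ yc yd s0 st tC.
have [u ust ->] : exists2 u, u \in `]s, t[%R & y t - y s = f (y u) * (t - s).
  apply: (@MVT _ y (f \o y)) => //.
    by move=> u; rewrite in_itv/= => /andP[su ut]; apply: yd; lra.
  apply: continuous_subspaceW yc => u /=; rewrite !in_itv/=; lra.
by exists u => //; rewrite in_itv/= in ust.
Qed.

Lemma within_continuous_eps (R : realType) (C : R) (y : R -> R) (s e : R) :
  {within `[0, C], continuous y} -> 0 <= s <= C -> 0 < e ->
  exists2 r, 0 < r & forall t, 0 <= t <= C -> `|t - s| < r -> `|y t - y s| < e.
Proof.
move=> /subspace_continuousP /(_ s) yc sC e0.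
have /cvgrPdist_lt/(_ e e0) : y x @[x --> within `[0, C]%classic (nbhs s)] --> y s.
  by apply: yc; rewrite /= in_itv.
move=> /= [r r0 rP]; exists r => // t tC ts.
by rewrite distrC; apply: rP => /=; rewrite ?in_itv//= distrC.
Qed.

(** Just above the level [a] the equation does not push the solution up, so
    there is no last time at which the solution could leave [a] upwards. *)
Lemma solution_barrier (R : realType) (f : R -> R) (y0 C a b : R) (y : R -> R) :
  solves_ivp f y0 C y -> y0 <= a -> a < b ->
  (forall x, a < x < b -> f x <= 0) ->
  forall t, 0 <= t <= C -> y t <= a.
Proof.
move=> ysol ya ab fle0 t tC; rewrite leNgt; apply/negP => yat.
have [y0E yc _] := ysol.
pose S := [set u | 0 <= u <= t /\ y u <= a].
have S0 : S 0 by split; [lra|rewrite y0E].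
have hS : has_sup S by split; [exists 0|exists t => u [/andP[]]].
pose s := sup S.
have s0 : 0 <= s by apply: (sup_upper_bound hS).
have st : s <= t by apply: ge_sup; [exists 0|move=> u [/andP[]]].
have sC : 0 <= s <= C by lra.
have ys : y s <= a.
  rewrite leNgt; apply/negP => yas.
  have [r r0 rP] := within_continuous_eps yc sC (e := y s - a) ltac:(lra).
  have [u [ut yu] su] := sup_adherent r0 hS.
  have us : u <= s by apply: (sup_upper_bound hS).
  have := rP u ltac:(lra); rewrite !ltr_norml -/s in su *; lra.
have st' : s < t.
  by rewrite lt_neqAle st andbT; apply: contraTneq yat => <-; rewrite -leNgt.
have [r r0 rP] := within_continuous_eps yc sC (e := b - y s) ltac:(lra).
pose v := s + Num.min (t - s) (r / 2).
have m0 : 0 < Num.min (t - s) (r / 2) by rewrite lt_min; lra.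
have m1 : Num.min (t - s) (r / 2) <= t - s by rewrite ge_min lexx.
have m2 : Num.min (t - s) (r / 2) <= r / 2 by rewrite ge_min lexx orbT.
have above u : s < u -> u <= t -> a < y u.
  move=> su ut; rewrite ltNge; apply/negP => yu.
  have : u <= s by apply: (sup_upper_bound hS); split => //; lra.
  by lra.
have [u uv] := solution_mvt (s := s) (t := v) ysol
  ltac:(lra) ltac:(rewrite /v; lra) ltac:(rewrite /v; lra).
have := above v ltac:(rewrite /v; lra) ltac:(rewrite /v; lra).
rewrite /v in uv *.
have yu : a < y u by apply: above; lra.
have := rP u ltac:(lra); rewrite !ltr_norml => yub.
have := fle0 (y u) ltac:(lra); rewrite (addrC s) addrK; nra.
Qed.

Section Ode.
Context (R : realType) (K : R).
Hypothesis K0 : 0 < K.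

Definition ode_den (x : R) : R := x ^+ 2 + (1 - x ^+ 2) * K.

Lemma ode_den_ge x : 0 <= x <= 1 -> Num.min 1 K <= ode_den x.
Proof.
move=> x01; have : Num.min 1 K <= 1 by rewrite ge_min lexx.
have : Num.min 1 K <= K by rewrite ge_min lexx orbT.
have : 0 <= x ^+ 2 <= 1 by rewrite sqr_ge0 expr_le1//; lra.
by rewrite /ode_den; nra.
Qed.

Let b0 : 0 < Num.min 1 K. Proof. by rewrite lt_min ltr01. Qed.

(** Makes the zero at [0] and the sign visible. *)
Lemma ode_rhs_fact x : ode_den x != 0 ->
  ode_rhs K x = - (x * (x + K * (1 - x))) / ode_den x.
Proof. by rewrite /ode_rhs /ode_den => d0; field. Qed.

Lemma ode_rhs_range x : 0 <= x <= 1 -> -1 <= ode_rhs K x <= 0.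
Proof.
move=> x01; have d0 : 0 < ode_den x by apply: lt_le_trans (ode_den_ge x01).
rewrite ode_rhs_fact ?gt_eqF// ler_pdivlMr// ler_pdivrMr// mul0r.
have : 0 <= K * (1 - x) by rewrite mulr_ge0 ?(ltW K0)//; lra.
have : 0 <= x * (x + K * (1 - x)).
  by rewrite mulr_ge0 ?addr_ge0 ?mulr_ge0 ?(ltW K0)//; lra.
by rewrite /ode_den; lra.
Qed.

Definition ode_lip : R := 3 * K * (1 + K) / (Num.min 1 K) ^+ 2.

Lemma ode_lip_ge0 : 0 <= ode_lip.
Proof. by rewrite divr_ge0 ?sqr_ge0// !mulr_ge0//; have := K0; lra. Qed.

Lemma ode_rhs_lipschitz x z : 0 <= x <= 1 -> 0 <= z <= 1 ->
  `|ode_rhs K x - ode_rhs K z| <= ode_lip * `|x - z|.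
Proof.
move=> x01 z01; have dx := ode_den_ge x01; have dz := ode_den_ge z01.
have dx0 := lt_le_trans b0 dx; have dz0 := lt_le_trans b0 dz.
rewrite (_ : ode_rhs K x - _ = (z - x) *
   (K * ((1 - x) * ((1 - K) * (z + x)) + ode_den x)) / (ode_den x * ode_den z)); last first.
  by rewrite /ode_rhs /ode_den in dx0 dz0 *; field; rewrite !gt_eqF.
rewrite -mulrA normrM distrC mulrC ler_wpM2r//.
rewrite normrM [X in _ * X]ger0_norm; last by rewrite invr_ge0 mulr_ge0// ltW.
rewrite ler_pdivrMr ?mulr_gt0//.
apply: (@le_trans _ _ (3 * K * (1 + K))).
  rewrite normrM gtr0_norm// (mulrC 3) -mulrA ler_pM2l// ler_norml /ode_den.
  have p01 : 0 <= (1 - x) * (z + x) <= 2 by nra.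
  have q01 : 0 <= x ^+ 2 <= 1 by rewrite sqr_ge0 expr_le1//; lra.
  have : 0 <= K * ((1 - x) * (z + x)) <= K * 2.
    by rewrite mulr_ge0 ?ler_pM2l ?(ltW K0)//; lra.
  have : 0 <= K * x ^+ 2 <= K * 1.
    by rewrite mulr_ge0 ?ler_pM2l ?(ltW K0)//; lra.
  lra.
rewrite /ode_lip -[leLHS](@divfK _ (Num.min 1 K ^+ 2)); last by rewrite expf_neq0// gt_eqF.
by rewrite ler_wpM2l ?ode_lip_ge0// expr2 ler_pM// ltW.
Qed.

Variables (C : R) (y : R -> R).
Hypothesis ysol : solves_ivp (ode_rhs K) 1 C y.

Lemma solution_le1 t : 0 <= t <= C -> y t <= 1.
Proof.
(* The denominator of the right-hand side stays positive on ]1, 1 + e[. *)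
pose e := Num.min 1 (1 / (4 * K)).
have e0 : 0 < e by rewrite lt_min ltr01 divr_gt0// mulr_gt0.
have e1 : e <= 1 by rewrite ge_min lexx.
have eK : e * K <= 1 / 4.
  rewrite (@le_trans _ _ (1 / (4 * K) * K))//.
    by rewrite ler_pM2r// ge_min lexx orbT.
  by rewrite (_ : _ / _ * K = 1 / 4)//; field; rewrite gt_eqF.
apply: (@solution_barrier _ _ _ _ _ (1 + e) _ ysol) => //; first by lra.
move=> x xe; have d0 : 0 < ode_den x.
  have : (x - 1) * K <= 1 / 4 by apply: le_trans eK; rewrite ler_pM2r//; lra.
  by rewrite /ode_den; nra.
rewrite ode_rhs_fact ?gt_eqF// ler_pdivrMr// mul0r oppr_le0 mulr_ge0//; first by lra.
have : (x - 1) * K <= 1 / 4 by apply: le_trans eK; rewrite ler_pM2r//; lra.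
by lra.
Qed.

(** The same barrier argument, for the equation satisfied by [- y]. *)
Lemma solution_ge0 t : 0 <= t <= C -> 0 <= y t.
Proof.
move=> tC; rewrite -oppr_le0.
(* On ]- e, 0[ the denominator and x + K (1 - x) are both positive. *)
pose e := Num.min (1 / 2) (K / 2).
have e0 : 0 < e by rewrite lt_min !divr_gt0.
have e1 : e <= 1 / 2 by rewrite ge_min lexx.
have eK : e <= K / 2 by rewrite ge_min lexx orbT.
have nsol : solves_ivp (fun x => - ode_rhs K (- x)) (-1) C (fun t => - y t).
  case: ysol => y1 yc yd; split; first by rewrite y1.
    by move=> x; apply: continuousN; exact: yc.
  by move=> s sC; rewrite opprK; apply: is_deriveN; exact: yd.
apply: (@solution_barrier _ _ _ _ _ e _ nsol) => //.
move=> x xe; have d0 : 0 < ode_den (- x).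
  by rewrite /ode_den sqrrN; have := K0; have : x ^+ 2 <= 1 / 4; nra.
rewrite ode_rhs_fact ?gt_eqF// mulNr opprK ler_pdivrMr// mul0r mulNr oppr_le0.
rewrite mulr_ge0//; first by lra.
by have := K0; nra.
Qed.

Lemma solution_itv t : 0 <= t <= C -> 0 <= y t <= 1.
Proof. by move=> tC; rewrite solution_ge0 ?solution_le1. Qed.

Lemma solution_decrement s t : 0 <= s -> s <= t -> t <= C ->
  - (t - s) <= y t - y s <= 0.
Proof.
move=> s0; rewrite le_eqVlt => /orP[/eqP ->|st] tC; first by rewrite !subrr oppr0 lexx.
have [u us ->] := solution_mvt ysol s0 st tC.
have := ode_rhs_range (solution_itv (t := u) ltac:(lra)); nra.
Qed.

(** The mean value theorem replaces the slope at [s] by the slope at a point in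
    between, where the solution differs by at most [t - s]. *)
Lemma solution_euler s t : 0 <= s -> s <= t -> t <= C ->
  `|y t - y s - (t - s) * ode_rhs K (y s)| <= ode_lip * (t - s) ^+ 2.
Proof.
move=> s0; rewrite le_eqVlt => /orP[/eqP ->|st] tC.
  by rewrite !subrr mul0r subrr normr0 expr0n mulr0.
have [u us ->] := solution_mvt ysol s0 st tC.
rewrite mulrC -mulrBr normrM gtr0_norm; last by lra.
rewrite expr2 mulrCA ler_pM2l; last by lra.
apply: le_trans (ode_rhs_lipschitz _ _) _; try (apply: solution_itv; lra).
rewrite ler_wpM2l ?ode_lip_ge0// ler_norml.
have := solution_decrement (s := s) (t := u) ltac:(lra) ltac:(lra) ltac:(lra); lra.
Qed.

End Ode.

Lemma solution_minus1 (R : realType) (y : R -> R) :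
  solves_ivp (fun _ : R => -1) 1 1 y -> forall t : R, 0 <= t <= 1 -> y t = 1 - t.
Proof.
move=> ysol t /andP[]; rewrite le_eqVlt => /orP[/eqP<-|t0] t1.
  by case: ysol => -> _ _; rewrite subr0.
have [u _] := solution_mvt ysol (lexx 0) t0 t1.
by case: ysol => -> _ _; lra.
Qed.

(** * The second moment of the deviation from the solution *)

Lemma discrete_gronwall (R : realType) (q B : R) (V : nat -> R) (M : nat) :
  0 <= q -> 0 <= B -> V 0 <= 0 ->
  (forall m, (m < M)%N -> V m.+1 <= (1 + q) * V m + B) ->
  forall m, (m <= M)%N -> V m <= B * m%:R * expR (q * m%:R).
Proof.
move=> q0 B0 V0 VS; elim=> [_|m IH mM]; first by rewrite mulr0 mul0r.
apply: (le_trans (VS _ mM)); have {}IH := IH (ltnW mM).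
rewrite -natr1 [q * _]mulrDr mulr1 expRD.
set E := expR (q * m%:R) in IH *; have E1 : 1 <= E by rewrite /E -expR0 ler_expR mulr_ge0.
have q1 : 1 + q <= expR q by exact: expR_ge1Dx.
have : (1 + q) * V m <= (B * m%:R * E) * expR q.
  apply: (@le_trans _ _ ((1 + q) * (B * m%:R * E))).
    by rewrite ler_wpM2l// addr_ge0.
  by rewrite mulrC ler_wpM2l// !mulr_ge0//; lra.
have : B * 1 <= B * (E * expR q).
  by rewrite ler_wpM2l// mulr_ege1//; lra.
by lra.
Qed.

Lemma law_edges (R : realType) (K : R) (n : nat) (d : measure_display)
    (T : measurableType d) (P : probability T R) (G : nat -> T -> sgraph n) :
  biased_process K P G ->
  forall m g, law P G m g != 0 -> (#|edges g| <= m)%N.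
Proof.
move=> GK; elim=> [|m IH] h.
  rewrite (law0 GK) pnatr_eq0 eqb0 negbK => /eqP ->.
  by rewrite cards0.
rewrite (law_succ GK) => s0.
have [g [lg sg]] : exists g, law P G m g != 0 /\ step_prob K g h != 0.
  apply: contrapT => ng; move/eqP: s0; apply; apply: big1 => g _.
  apply: contrapT => /eqP; rewrite mulf_eq0 negb_or => /andP[lg sg].
  by apply: ng; exists g.
by apply: leq_trans (step_edges sg) _; rewrite ltnS IH.
Qed.

Lemma isolated_edgeless n : #|isolated (edgeless n)| = n.
Proof.
rewrite (_ : isolated _ = [set: 'I_n]%SET) ?cardsT ?card_ord//.
by apply/finset.setP => v; rewrite !inE; apply/forall_inP => e; rewrite inE.
Qed.

Section SecondMoment.
Context (R : realType) (K C : R) (y : R -> R).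
Hypotheses (K0 : 0 < K) (C0 : 0 < C) (ysol : solves_ivp (ode_rhs K) 1 C y).

(** Let [u] be the deviation before the step. Its mean increment is at most a
    constant times [(1 + |u|) / n]: up to sign and [O(1/n)], the mean loss and the
    move of [n * y] are twice the right-hand side of the equation, taken at two
    points that are [|u| / n] apart. Multiplied by [u], where [|u| <= n], this
    contributes [O(u ^+ 2 / n + 1)] to the second moment, and the square of the
    increment contributes a bounded amount. *)
Lemma second_moment_recursion : exists A B N0 : R, [/\ 0 <= A, 0 <= B &
  forall (n m : nat) (g : sgraph n), N0 <= n%:R -> 0 < n%:R :> R ->
    (m.+1)%:R <= C * n%:R / 2 -> (#|edges g| <= m)%N ->
    \sum_h step_prob K g h *
       (#|isolated h|%:R - n%:R * y (2 * m.+1%:R / n%:R)) ^+ 2 <=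
    (1 + A / n%:R) * (#|isolated g|%:R - n%:R * y (2 * m%:R / n%:R)) ^+ 2 + B].
Proof.
have [c [N0 [c0 drift]]] := mean_loss_drift K0 C0.
pose L := ode_lip K; have L0 : 0 <= L := ode_lip_ge0 K0.
exists (4 * L), (4 + 2 * c + 8 * L), N0; split; [lra|lra|].
move=> n m g nN n0 mC em; set N := n%:R in nN n0 mC *.
have mC' : m%:R + 1 <= C * N / 2 by rewrite natr1.
have mR : #|edges g|%:R <= C * N / 2.
  by apply: (@le_trans _ _ m%:R); [rewrite ler_nat|lra].
have [W0 dr] := drift n g nN mR; rewrite -/N in dr.
rewrite -[m.+1%:R]natr1 mulrDr mulr1 mulrDl.
set t := 2 * m%:R / N; set h := 2 / N.
have h0 : 0 < h by rewrite divr_gt0.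
have t0 : 0 <= t by rewrite divr_ge0 ?mulr_ge0// ltW.
have thC : t + h <= C by rewrite /t /h -mulrDl ler_pdivrMr//; lra.
have tC : 0 <= t <= C by lra.
have yt := solution_itv K0 ysol tC.
have hN : N * h = 2 by rewrite /h; field; rewrite gt_eqF.
have := solution_decrement K0 ysol t0 (t := t + h) ltac:(lra) thC.
have := solution_euler K0 ysol t0 (t := t + h) ltac:(lra) thC.
rewrite (addrC t h) addrK (addrC h); set dy := y (t + h) - y t => eul dec.
have -> : N * y (t + h) = N * y t + N * dy by rewrite /dy; ring.
have Ndy : -2 <= N * dy <= 0.
  have : N * - h <= N * dy by rewrite ler_pM2l//; lra.
  have : N * dy <= N * 0 by rewrite ler_pM2l//; lra.
  lra.
apply: (le_trans (second_moment_step (N * y t) (ltW K0) W0 Ndy)).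
set x := #|isolated g|%:R in dr *.
have x0 : 0 <= x by [].
have xN : x <= N by rewrite ler_nat -[n in (_ <= n)%N]card_ord max_card.
have xN1 : 0 <= x / N <= 1 by rewrite divr_ge0 ?(ltW n0)//= ler_pdivrMr ?mul1r.
set u := x - N * y t.
have uN : `|u| <= N.
  have : 0 <= N * y t <= N * 1 by rewrite mulr_ge0 ?ler_pM2l ?(ltW n0)//; lra.
  by rewrite ler_norml /u; lra.
have lip := ode_rhs_lipschitz K0 xN1 yt; rewrite -/L in lip eul; clearbody L.
have xu : `|x / N - y t| = `|u| / N.
  by rewrite -[in RHS](gtr0_norm n0) -normf_div /u; congr (`|_|); field; rewrite gt_eqF.
have bound : `|mean_loss K g + N * dy| <= (c + 4 * L + 2 * L * `|u|) / N.
  rewrite (_ : _ + N * dy = (mean_loss K g + 2 * ode_rhs K (x / N))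
     + N * (dy - h * ode_rhs K (y t)) - 2 * (ode_rhs K (x / N) - ode_rhs K (y t))); last first.
    have : N * h * ode_rhs K (y t) = 2 * ode_rhs K (y t) by rewrite hN.
    by lra.
  have e1 : `|N * (dy - h * ode_rhs K (y t))| <= 4 * L / N.
    rewrite normrM gtr0_norm// (le_trans (ler_wpM2l (ltW n0) eul))//.
    by rewrite /h le_eqVlt; apply/orP; left; apply/eqP; field; rewrite gt_eqF.
  have e2 : `|2 * (ode_rhs K (x / N) - ode_rhs K (y t))| <= 2 * L * `|u| / N.
    rewrite normrM ger0_norm// -!mulrA ler_pM2l//.
    by rewrite -xu.
  rewrite [leRHS]mulrDl (mulrDl c).
  apply: (le_trans (ler_normB _ _)); apply: lerD => //.
  by apply: (le_trans (ler_normD _ _)); exact: lerD.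
have : - (2 * u * (mean_loss K g + N * dy)) <=
    2 * `|u| * ((c + 4 * L + 2 * L * `|u|) / N).
  apply: (le_trans (ler_norm _)); rewrite normrN normrM normrM ger0_norm//.
  by rewrite ler_wpM2l// mulr_ge0.
have : 2 * `|u| * ((c + 4 * L + 2 * L * `|u|) / N) =
    2 * (c + 4 * L) * (`|u| / N) + 4 * L / N * u ^+ 2.
  by rewrite -(real_normK (num_real u)); field; rewrite gt_eqF.
have : 2 * (c + 4 * L) * (`|u| / N) <= 2 * (c + 4 * L) * 1.
  by rewrite ler_wpM2l ?ler_pdivrMr ?mul1r//; lra.
by rewrite mulrDl; lra.
Qed.

(** After [m] steps the recursion gives at most [B * m * exp (A * m / n)], which is
    [O(n)] because [m] is at most [C * n / 2]. *)
Lemma second_moment_bound : exists A N0 : R, 0 <= A /\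
  forall (n : nat) (d : measure_display) (T : measurableType d)
    (P : probability T R) (G : nat -> T -> sgraph n),
  N0 <= n%:R -> 0 < n%:R :> R -> biased_process K P G ->
  forall m, m%:R <= C * n%:R / 2 ->
  \sum_g law P G m g * (#|isolated g|%:R - n%:R * y (2 * m%:R / n%:R)) ^+ 2 <=
  A * n%:R.
Proof.
have [A [B [N0 [A0 B0 rec]]]] := second_moment_recursion.
exists (B * (C / 2) * expR (A * (C / 2))), N0; split.
  by rewrite !mulr_ge0 ?expR_ge0// ltW// divr_gt0.
move=> n d T P G nN n0 GK m mC.
pose V m := \sum_g law P G m g *
  (#|isolated g|%:R - n%:R * y (2 * m%:R / n%:R)) ^+ 2.
have V0 : V 0%N <= 0.
  rewrite /V big1// => g _; rewrite (law0 GK); case: eqVneq => [->|]; last by rewrite mul0r.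
  by rewrite isolated_edgeless mulr0 mul0r; case: ysol => -> _ _; rewrite mulr1 subrr expr0n mulr0.
have VS k : (k < m)%N -> V k.+1 <= (1 + A / n%:R) * V k + B.
  move=> km; rewrite /V (expectation_succ GK) mulr_sumr.
  have -> : B = \sum_g law P G k g * B by rewrite -mulr_suml (law_sum1 GK) mul1r.
  rewrite -big_split/=; apply: ler_sum => g _.
  have [->|lg] := eqVneq (law P G k g) 0; first by rewrite !mul0r mulr0 addr0.
  rewrite mulrCA -mulrDr ler_wpM2l ?law_ge0//; apply: rec => //.
    by apply: le_trans mC; rewrite ler_nat.
  exact: (law_edges GK).
have AN0 : 0 <= A / n%:R by rewrite divr_ge0// ltW.
apply: (le_trans (discrete_gronwall AN0 B0 V0 VS (leqnn m))).
rewrite [leRHS]mulrAC -[B * _ * n%:R]mulrA; apply: ler_pM.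
- by rewrite mulr_ge0.
- exact: expR_ge0.
- by rewrite ler_wpM2l//; lra.
- rewrite ler_expR -mulrA ler_wpM2l// mulrC ler_pdivrMr//; lra.
Qed.

End SecondMoment.

(** * From one time to all times *)

Section Close.
Context (R : realType) (n : nat) (d : measure_display) (T : measurableType d).
Context (P : probability T R) (G : nat -> T -> sgraph n).
Hypothesis mG : forall m g, measurable [set w | G m w = g].

Lemma measurable_close_upto (y : R -> R) (C e : R) :
  measurable (close_upto G y C e).
Proof.
rewrite (_ : close_upto G y C e = \bigcap_m [set w | forall t, 0 <= t <= C ->
    Num.truncn (t * n%:R / 2) = m -> `|iso_frac R (G m w) - y t| <= e]).
  apply: bigcapT_measurable => m.
  exact: (measurable_fin_preimage (fun g => forall t, 0 <= t <= C ->
    Num.truncn (t * n%:R / 2) = m -> `|iso_frac R g - y t| <= e) (mG m)).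
apply/seteqP; split=> [w wc m _ t tC <-|w wc t tC]; first exact: wc.
exact: (wc (Num.truncn (t * n%:R / 2))).
Qed.

Lemma prob_ge_union_bound (A N : set T) (B : nat -> set T) (J : nat) (b : R) :
  measurable A -> measurable N -> (forall j, measurable (B j)) ->
  ~` A `<=` N `|` \bigcup_(j < J) B j -> P N = 0%E ->
  (forall j, (j < J)%N -> (P (B j) <= b%:E)%E) ->
  ((1 - J%:R * b)%:E <= P A)%E.
Proof.
move=> mA mN mB sub N0 Bb.
rewrite -[A]setCK probability_setC; last exact: measurableC.
have mU : measurable (\bigcup_(j < J) B j) by apply: bigcup_measurable.
have PC : (P (~` A) <= (J%:R * b)%:E)%E.
  apply: (@le_trans _ _ (P (N `|` \bigcup_(j < J) B j))).
    by apply: le_measure; rewrite ?inE//; [exact: measurableC|exact: measurableU].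
  apply: (@le_trans _ _ (P N + P (\bigcup_(j < J) B j))%E); first exact: measureU2.
  rewrite N0 add0e bigcup_mkord; apply: (@le_trans _ _ (\sum_(j < J) P (B j))%E).
    exact: Boole_inequality.
  apply: (@le_trans _ _ (\sum_(j < J) b%:E)%E); first by apply: lee_sum => j _; exact: Bb.
  by rewrite sumEFin sumr_const card_ord mulr_natl.
rewrite EFinB; apply: leeB => //.
Qed.

End Close.

Section Paths.
Context (R : realType) (K : R) (n : nat) (d : measure_display).
Context (T : measurableType d) (P : probability T R) (G : nat -> T -> sgraph n).

Lemma legal_path w : ~ illegal K G w ->
  G 0 w = edgeless n /\ forall m, step_prob K (G m w) (G m.+1 w) != 0.
Proof.
move=> /not_orP[/contrapT G0 Gm]; split=> // m.
by apply/eqP => s0; apply: Gm; exists m.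
Qed.

Lemma path_isolated w m k : ~ illegal K G w ->
  `|#|isolated (G (m + k) w)|%:R - #|isolated (G m w)|%:R| <= 2 * k%:R :> R.
Proof.
move=> /legal_path[_ Gs]; elim: k => [|k IH]; first by rewrite addn0 subrr normr0 mulr0.
have := step_isolated (Gs (m + k)%N); rewrite [(m + k.+1)%N]addnS => /andP[l1 l2].
have {}l2 : #|isolated (G (m + k)%N w)|%:R <= #|isolated (G (m + k).+1 w)|%:R + 2 :> R.
  by rewrite -natrD ler_nat.
move: l1; rewrite -(ler_nat R) => l1.
by rewrite -[k.+1%:R]natr1; move: IH; rewrite !ler_norml; lra.
Qed.

End Paths.

Section Concentration.
Context (R : realType) (K C : R) (y : R -> R).
Hypotheses (K0 : 0 < K) (C0 : 0 < C) (ysol : solves_ivp (ode_rhs K) 1 C y).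

(** A path that is close to the solution at the multiples of [s] stays close to it
    in between, because neither can move far in [s] steps. *)
Lemma close_of_grid (n s : nat) (l : R) (d : measure_display)
    (T : measurableType d) (G : nat -> T -> sgraph n) (w : T) :
  (0 < n)%N -> (0 < s)%N -> ~ illegal K G w ->
  (forall j, (j < (Num.truncn (C * n%:R / 2) %/ s).+1)%N ->
    `|#|isolated (G (j * s)%N w)|%:R - n%:R * y (2 * (j * s)%:R / n%:R)| < l) ->
  close_upto G y C ((l + 4 * s%:R) / n%:R) w.
Proof.
move=> n0 s0 wl grid t /andP[t0 tC]; rewrite /at_time /iso_frac.
have N0 : 0 < n%:R :> R by rewrite ltr0n.
have tn0 : 0 <= t * n%:R / 2 by rewrite divr_ge0// mulr_ge0.
have := truncn_itv tn0; have mM : (Num.truncn (t * n%:R / 2) <= Num.truncn (C * n%:R / 2))%N.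
  by apply: le_truncn; rewrite ler_pM2r// ler_pM2r.
move: (Num.truncn _) mM => m mM /andP[mt tm].
have js : (m %/ s < (Num.truncn (C * n%:R / 2) %/ s).+1)%N by rewrite ltnS leq_div2r.
have := grid _ js; have := path_isolated (R := R) (m %/ s * s) (m %% s) wl.
rewrite -divn_eq; set k := (m %/ s * s)%N => path gridk.
have km : (k <= m)%N by rewrite leq_divM.
have mk : (m < k + s)%N by rewrite [m in (m < _)%N](divn_eq m s) ltn_add2l ltn_mod.
have ks : (m %% s)%:R <= s%:R :> R by rewrite ler_nat ltnW// ltn_mod.
have kt : 2 * k%:R / n%:R <= t.
  rewrite ler_pdivrMr//; have : k%:R <= m%:R :> R by rewrite ler_nat.
  lra.
have k0 : 0 <= 2 * k%:R / n%:R :> R by rewrite divr_ge0 ?mulr_ge0.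
have tk : n%:R * (t - 2 * k%:R / n%:R) <= 2 * s%:R.
  rewrite mulrBr [n%:R * (_ / _)]mulrC divfK ?gt_eqF//.
  have : m.+1%:R <= k%:R + s%:R :> R by rewrite -natrD ler_nat.
  lra.
have dec := solution_decrement K0 ysol k0 kt tC.
have dec1 : n%:R * (y t - y (2 * k%:R / n%:R)) <= 0 by rewrite pmulr_rle0//; lra.
have dec2 : - (2 * s%:R) <= n%:R * (y t - y (2 * k%:R / n%:R)).
  have : n%:R * - (t - 2 * k%:R / n%:R) <= n%:R * (y t - y (2 * k%:R / n%:R)).
    by rewrite ler_pM2l//; lra.
  lra.
rewrite ler_pdivlMr// -[X in _ * X](gtr0_norm N0) -normrM mulrBl divfK ?gt_eqF//.
move: gridk path; rewrite !ler_norml ltr_norml; lra.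
Qed.

(** With [q ^+ 4 = n], use a grid of spacing about [q ^+ 3], so that there are [O(q)]
    grid times. At each of them the deviation exceeds [q ^+ 3] with probability
    [O(n / q ^+ 6)], that is [O(q ^- 2)], and the union bound leaves [O(q ^- 1)]. *)
Lemma prob_close : exists c N0 : R,
  forall (n : nat) (d : measure_display) (T : measurableType d)
    (P : probability T R) (G : nat -> T -> sgraph n),
  N0 <= n%:R -> (0 < n)%N -> biased_process K P G ->
  ((1 - c * n%:R `^ (- (1 / 4)))%:E <=
     P (close_upto G y C (9 * n%:R `^ (- (1 / 4)))))%E.
Proof.
have [A [N0 [A0 mom]]] := second_moment_bound K0 C0 ysol.
exists ((C / 2 + 1) * A), N0 => n d T P G nN n0 GK.
have N_gt0 : 0 < n%:R :> R by rewrite ltr0n.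
have mG m g : measurable [set w | G m w = g] by case: GK.
rewrite powRN; set q := n%:R `^ (1 / 4).
have q1 : 1 <= q.
  by rewrite -(powRr0 n%:R); apply: ler_powR; rewrite ?ler1n// divr_ge0.
have q0 : 0 < q by lra.
have qn : n%:R = q ^+ 4.
  by rewrite /q -powR_mulrn ?powR_ge0// -powRrM mul1r mulVf ?pnatr_eq0// powRr1.
have q3 : 1 <= q ^+ 3 by rewrite exprn_ege1.
pose s := (Num.truncn (q ^+ 3)).+1.
have s_gt : q ^+ 3 < s%:R := truncnS_gt _.
have s_le : s%:R <= 2 * q ^+ 3.
  have q30 : 0 <= q ^+ 3 by lra.
  by have /andP[tq _] := truncn_itv q30; rewrite -[s%:R]natr1; lra.
pose M := Num.truncn (C * n%:R / 2).
have Cn0 : 0 <= C * n%:R / 2 by rewrite divr_ge0 ?mulr_ge0// ltW.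
have MC : M%:R <= C * n%:R / 2 by have /andP[] := truncn_itv Cn0.
pose J := (M %/ s).+1.
pose D (k : nat) (g : sgraph n) : R := #|isolated g|%:R - n%:R * y (2 * k%:R / n%:R).
pose B (j : nat) := [set w | q ^+ 3 <= `|D (j * s)%N (G (j * s)%N w)|].
have mB j : measurable (B j).
  exact: (measurable_fin_preimage (fun g => q ^+ 3 <= `|D (j * s)%N g|)).
have PB j : (j < J)%N -> (P (B j) <= (A / q ^+ 2)%:E)%E.
  move=> jJ; rewrite (_ : A / q ^+ 2 = A * n%:R / (q ^+ 3) ^+ 2); last first.
    by rewrite qn; field; rewrite gt_eqF.
  apply: (prob_chebyshev GK); first by rewrite exprn_gt0.
  apply: mom => //; apply: le_trans MC; rewrite ler_nat.
  by rewrite -leq_divRL.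
have JR : J%:R <= (C / 2 + 1) * q.
  rewrite -[J%:R]natr1 mulrDl mul1r lerD//.
  have sM : (M %/ s)%:R * s%:R <= M%:R :> R by rewrite -natrM ler_nat leq_divM.
  rewrite -(@ler_pM2r _ (q ^+ 3)) ?exprn_gt0//.
  apply: (@le_trans _ _ ((M %/ s)%:R * s%:R)); first by rewrite ler_wpM2l// ltW.
  by apply: (le_trans sM); apply: (le_trans MC); rewrite qn exprS; lra.
have sub : ~` close_upto G y C (9 / q) `<=` illegal K G `|` \bigcup_(j < J) B j.
  move=> w; apply: contra_notP => /not_orP[wl wB].
  suff : close_upto G y C ((q ^+ 3 + 4 * s%:R) / n%:R) w.
    move=> wc t tC; apply: (le_trans (wc t tC)).
    rewrite ler_pdivrMr// (_ : 9 / q * _ = 9 * q ^+ 3); first lra.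
    by rewrite qn; field; rewrite gt_eqF.
  apply: close_of_grid => // j jJ; rewrite ltNge; apply/negP => jB.
  by apply: wB; exists j.
have mE := measurable_close_upto mG y C (9 / q).
apply: le_trans (prob_ge_union_bound mE (measurable_illegal GK) mB sub (prob_illegal GK) PB).
rewrite lee_fin lerD2l lerN2.
apply: (@le_trans _ _ ((C / 2 + 1) * q * (A / q ^+ 2))).
  by rewrite ler_wpM2r// divr_ge0 ?sqr_ge0.
by rewrite le_eqVlt; apply/orP; left; apply/eqP; field; rewrite gt_eqF.
Qed.

End Concentration.

(** * The limit of large graphs *)

Lemma cvg_natr_quarter (R : realType) :
  (fun n : nat => n%:R `^ (- (1 / 4)) : R) @ \oo --> (0 : R).
Proof.
apply/cvgrPdist_le => e e0; near=> n.
rewrite sub0r normrN ger0_norm ?powR_ge0// powRN.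
have ne : e^-1 ^+ 4 <= n%:R by near: n; exact: nbhs_infty_ger.
rewrite -[e]invrK lef_pV2 ?posrE ?invr_gt0 ?powR_gt0//; last first.
  by apply: lt_le_trans ne; rewrite exprn_gt0 ?invr_gt0.
have -> : e^-1 = (e^-1 ^+ 4) `^ (1 / 4).
  have e'0 : 0 <= e^-1 by rewrite invr_ge0 ltW.
  by rewrite -powR_mulrn// -powRrM mul1r mulfV ?pnatr_eq0// powRr1.
by apply: ge0_ler_powR; rewrite ?nnegrE ?divr_ge0// exprn_ge0// invr_ge0 ltW.
Unshelve. all: by end_near. Qed.

Lemma cvg_prob_1 (R : realType) (d : nat -> measure_display)
    (T : forall n, measurableType (d n)) (P : forall n, probability (T n) R)
    (A : forall n, set (T n)) (c N0 : R) :
  (forall n, measurable (A n)) ->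
  (forall n : nat, N0 <= n%:R -> (0 < n)%N ->
     ((1 - c * n%:R `^ (- (1 / 4)))%:E <= P n (A n))%E) ->
  (fun n => P n (A n)) @ \oo --> 1%E.
Proof.
move=> mA PA.
apply: (@squeeze_cvge _ _ _ _
  (fun n : nat => (1 - c * n%:R `^ (- (1 / 4)))%:E) _ (cst 1%E)).
- near=> n; rewrite probability_le1//= andbT; apply: PA.
    by near: n; exact: nbhs_infty_ger.
  by near: n; exact: nbhs_infty_gt.
- apply: cvg_EFin; first exact: nearW.
  rewrite -[X in _ --> X](subr0 1) -[X in 1 - X](mulr0 c).
  apply: cvgB; first exact: cvg_cst.
  by apply: cvgM; [exact: cvg_cst|exact: cvg_natr_quarter].
- exact: cvg_cst.
Unshelve. all: by end_near. Qed.

(** * The deterministic case of weight zero *)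

Section Zero.
Context (R : realType) (n : nat).

Lemma missing_neq0 (g : sgraph n) : (2 <= #|isolated g|)%N -> missing g != finset.set0.
Proof.
move=> /card_gt1P[u [v [ui vi uv]]]; apply/finset.set0Pn; exists [set u; v]%SET.
rewrite !inE cards2 uv eqxx andbT; apply/negP => eg.
have /finset.setP/(_ u) := isolated_edge eg.
by rewrite finset.inE ui !inE eqxx.
Qed.

(** While two isolated vertices remain, edges of weight [0] are never chosen, so
    each step joins two isolated vertices. *)
Lemma step_isolated0 (g h : sgraph n) : (2 <= #|isolated g|)%N ->
  step_prob (0 : R) g h != 0 -> #|isolated h| = (#|isolated g| - 2)%N.
Proof.
move=> g2 /step_possible[[m0 _]|[e [eg he]]].
  by have := missing_neq0 g2; rewrite m0 eqxx.
rewrite /weight ltnNge g2/=; case: ifPn => [eI _|_]; last by rewrite eqxx.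
by rewrite (isolated_add he) cardsD (finset.setIidPr eI) (card_missing_edge eg).
Qed.

Lemma path_isolated0 (d : measure_display) (T : measurableType d)
    (G : nat -> T -> sgraph n) w m : ~ illegal (0 : R) G w -> (2 * m <= n)%N ->
  #|isolated (G m w)| = (n - 2 * m)%N.
Proof.
move=> /legal_path[G0 Gs]; elim: m => [_|m IH mn].
  by rewrite G0 isolated_edgeless muln0 subn0.
have {}IH := IH ltac:(lia).
by rewrite (step_isolated0 _ (Gs m)) IH; lia.
Qed.

End Zero.

Lemma prob_close0 (R : realType) (y : R -> R) (n : nat) (d : measure_display)
    (T : measurableType d) (P : probability T R) (G : nat -> T -> sgraph n) :
  (forall t : R, 0 <= t <= 1 -> y t = 1 - t) -> (0 < n)%N ->
  biased_process 0 P G ->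
  (1 <= P (close_upto G y 1 (2 * n%:R `^ (- (1 / 4)))))%E.
Proof.
move=> yE n0 GK; have mG m g : measurable [set w | G m w = g] by case: GK.
have N0 : 0 < n%:R :> R by rewrite ltr0n.
have mE := measurable_close_upto mG y 1 (2 * n%:R `^ (- (1 / 4))).
have sub : ~` close_upto G y 1 (2 * n%:R `^ (- (1 / 4))) `<=`
    illegal (0 : R) G `|` \bigcup_(j < 0) set0.
  move=> w; apply: contra_notP => /not_orP[wl _] t /andP[t0 t1].
  rewrite yE ?t0// /at_time /iso_frac.
  have tn0 : 0 <= t * n%:R / 2 by rewrite divr_ge0// mulr_ge0.
  have := truncn_itv tn0; move: (Num.truncn _) => m /andP[mt tm].
  have tn : t * n%:R <= 1 * n%:R by rewrite ler_pM2r.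
  have mn : (2 * m <= n)%N by rewrite -(ler_nat R) natrM; lra.
  rewrite (path_isolated0 wl mn) natrB// natrM.
  apply: (@le_trans _ _ (2 / n%:R)).
    rewrite ler_pdivlMr// -[X in _ * X](gtr0_norm N0) -normrM.
    rewrite mulrBl divfK ?gt_eqF// ler_norml.
    by move: tm; rewrite -[m.+1%:R]natr1; lra.
  rewrite ler_pM2l// powRN lef_pV2 ?posrE ?powR_gt0//.
  by rewrite -[leRHS]powRr1// ler_powR ?ler1n//; lra.
(* The only exceptional set is the null set of illegal paths. *)
have := prob_ge_union_bound (J := 0) (b := 0) mE (measurable_illegal GK)
  (fun=> measurable0) sub (prob_illegal GK).
by rewrite mulr0 subr0; apply.
Qed.

(** * The theorem *)

Theorem theorem1p1 (R : realType) :
  (forall (K C : R) (y : R -> R),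
     0 < K -> 0 < C -> solves_ivp (ode_rhs K) 1 C y ->
     exists M : R,
       forall (d : nat -> measure_display)
              (T : forall n : nat, measurableType (d n))
              (P : forall n : nat, probability (T n) R)
              (G : forall n : nat, nat -> T n -> sgraph n),
         (forall n : nat, biased_process K (P n) (G n)) ->
         (fun n : nat =>
            P n (close_upto (G n) y C (M * n%:R `^ (- (1 / 4)))))
           @ \oo --> 1%E)
  /\
  (forall y : R -> R,
     solves_ivp (fun _ : R => -1) 1 1 y ->
     (forall t : R, 0 <= t <= 1 -> y t = 1 - t) /\
     exists M : R,
       forall (d : nat -> measure_display)
              (T : forall n : nat, measurableType (d n))
              (P : forall n : nat, probability (T n) R)
              (G : forall n : nat, nat -> T n -> sgraph n),
         (forall n : nat, biased_process 0 (P n) (G n)) ->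
         (fun n : nat =>
            P n (close_upto (G n) y 1 (M * n%:R `^ (- (1 / 4)))))
           @ \oo --> 1%E).
Proof.
split=> [K C y K0 C0 ysol|y ysol].
  have [c [N0 close]] := prob_close K0 C0 ysol.
  exists 9 => d T P G GK; apply: (cvg_prob_1 (c := c) (N0 := N0)) => n.
    by apply: measurable_close_upto => m g; case: (GK n).
  by move=> nN n0; exact: close.
have yE := solution_minus1 ysol; split=> //.
exists 2 => d T P G GK; apply: (cvg_prob_1 (c := 0) (N0 := 0)) => n.
  by apply: measurable_close_upto => m g; case: (GK n).
by move=> _ n0; rewrite mul0r subr0; exact: prob_close0.
Qed.
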